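(* Let $n\in\mathbb{N}$ and let $\delta$ be a positive infinitesimal in ${}^*\mathbb{R}$. (i) Suppose $U\subset\mathbb{R}^n$ is a neighborhood of $0$ and $f:U\to\mathbb{R}$ is a function. If ${}^*f(\xi)=0$ for all $\xi\in B_\delta$, then there is a neighborhood $V\subset\mathbb{R}^n$ of $0$ such that $f|_V$ is identically zero, i.e. the germ $[f]$ is the zero germ. (ii) That is, the map $\mathcal{R}_\delta:\mathcal{G}\to{}^{\sigma}F(B_\delta)$, $[f]\mapsto {}^*f|_{B_\delta}$, is an $\mathbb{R}$-algebra isomorphism. (iii) Furthermore, $\mathcal{R}_\delta$ is a partial order isomorphism: for $[f],[g]\in\mathcal{G}$, $[f]<[g]$ if and only if ${}^*f<{}^*g$ on $B_\delta$, and the same statement holds with $<$ replaced by $\le$, $>$ or $\ge$.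
   Context: A sufficiently saturated nonstandard extension $X\mapsto{}^*X$ (Robinson nonstandard analysis, at least an enlargement) is fixed. $B_\delta=\{\xi\in{}^*\mathbb{R}^n:|\xi|\le\delta\}$. $\mathcal{G}=\mathcal{G}_{n,1}$ is the ring (without unit; an $\mathbb{R}$-algebra under pointwise operations) of germs at $0$ of arbitrary functions $f:(\mathbb{R}^n,0)\to(\mathbb{R},0)$, i.e. real-valued functions $f$ defined on a (convex) neighborhood of $0$ with $f(0)=0$, two being equivalent if they agree on a neighborhood of $0$; $[f]$ is the germ of $f$. ${}^{\sigma}F(B_\delta)$ is the (external) algebra of standard functions on $B_\delta$, i.e. of restrictions ${}^*f|_{B_\delta}$ where $f$ is a real-valued function defined on a neighborhood of $0$ in $\mathbb{R}^n$ with $f(0)=0$; it is an $\mathbb{R}$-algebra by identifying $c\in\mathbb{R}$ with ${}^*c$. Order on germs: $[f]<[g]$ if there are a neighborhood $U$ of $0$ and representatives $f,g$ defined on $U$ with $f(x)<g(x)$ for all $x\in U$; $\le,>,\ge$ are defined similarly. ${}^*f<{}^*g$ on $B_\delta$ means ${}^*f(\xi)<{}^*g(\xi)$ for every $\xi\in B_\delta$, and similarly for $\le,>,\ge$. *)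

(* Defs.v *)
From HB Require Import structures.
From mathcomp Require Import all_boot all_order all_algebra generic_quotient.
From mathcomp Require Import all_classical all_reals all_analysis.
Import Order.TTheory GRing.Theory Num.Theory numFieldNormedType.Exports.

Set Implicit Arguments.
Unset Strict Implicit.
Unset Printing Implicit Defensive.

Local Open Scope classical_set_scope.
Local Open Scope ring_scope.
Local Open Scope quotient_scope.

(* Nonstandard extensions are set up in Robinson's original (typed) form: the
   standard universe is the hierarchy of finite types over the reals, and an
   extension is an elementary extension of it for the many-sorted language in
   which every standard element, function and set has a name.  Quantifiers over
   higher types are formulas of this language, through the sorts [Pow s] and
   the named membership relation [set p | p.2 p.1] on [Prod s (Pow s)]; in the
   extension they range over the internal sets. *)
Inductive sort : Type :=
| Reals
| Vec of nat
| Prod of sort & sort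
| Pow of sort.

Fixpoint el (R : realType) (s : sort) : Type :=
  match s with
  | Reals => R
  | Vec n => 'rV[R]_n
  | Prod s t => (el R s * el R t)%type
  | Pow s => set (el R s)
  end.

Record interp (R : realType) := Interp {
  carrier :> sort -> Type;
  star_el : forall s, el R s -> carrier s;
  star_fun : forall s t, (el R s -> el R t) -> carrier s -> carrier t;
  star_set : forall s, set (el R s) -> set (carrier s);
  star_pair : forall s t, carrier s -> carrier t -> carrier (Prod s t) }.

Arguments star_el {R} i s.
Arguments star_fun {R} i s t.
Arguments star_set {R} i s.
Arguments star_pair {R} i {s t}.

Definition standard (R : realType) : interp R :=
  @Interp R (el R) (fun _ a => a) (fun _ _ f => f) (fun _ A => A)
    (fun s t (a : el R s) (b : el R t) => (a, b)).

(* Variables are de Bruijn indices; [ctx] lists the sorts of the free ones. *)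
Notation ctx := (seq sort).

Inductive var : ctx -> sort -> Type :=
| V0 G s : var (s :: G) s
| VS G s t : var G s -> var (t :: G) s.

Inductive term (R : realType) (G : ctx) : sort -> Type :=
| Var s : var G s -> term R G s
| Cst s : el R s -> term R G s
| App s t : (el R s -> el R t) -> term R G s -> term R G t
| Pair s t : term R G s -> term R G t -> term R G (Prod s t).

Inductive formula (R : realType) : ctx -> Type :=
| Eq G s : term R G s -> term R G s -> formula R G
| In G s : set (el R s) -> term R G s -> formula R G
| Not G : formula R G -> formula R G
| And G : formula R G -> formula R G -> formula R G
| Imp G : formula R G -> formula R G -> formula R G
| All G s : formula R (s :: G) -> formula R G
| Ex G s : formula R (s :: G) -> formula R G.

Fixpoint env (R : realType) (M : interp R) (G : ctx) : Type :=
  if G is s :: G' then (M s * env M G')%type else unit.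

Fixpoint lookup (R : realType) (M : interp R) G s (x : var G s) :
    env M G -> M s :=
  match x with
  | V0 _ _ => fun e => e.1
  | VS _ _ _ y => fun e => lookup y e.2
  end.

Fixpoint eval (R : realType) (M : interp R) G (e : env M G) s
    (u : term R G s) : M s :=
  match u with
  | Var _ x => lookup x e
  | Cst s c => star_el M s c
  | App s t f v => star_fun M s t f (eval e v)
  | Pair _ _ v w => star_pair M (eval e v) (eval e w)
  end.

Fixpoint holds (R : realType) (M : interp R) G (p : formula R G) :
    env M G -> Prop :=
  match p with
  | Eq _ _ u v => fun e => eval e u = eval e v
  | In _ s A u => fun e => star_set M s A (eval e u)
  | Not _ p => fun e => ~ holds p e
  | And _ p q => fun e => holds p e /\ holds q e
  | Imp _ p q => fun e => holds p e -> holds q e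
  | All G s p => fun e => forall a : M s, @holds R M (s :: G) p (a, e)
  | Ex G s p => fun e => exists a : M s, @holds R M (s :: G) p (a, e)
  end.

Definition transfer_principle (R : realType) (M : interp R) : Prop :=
  forall p : formula R [::],
    @holds R (standard R) [::] p tt <-> @holds R M [::] p tt.

Definition is_enlargement (R : realType) (M : interp R) : Prop :=
  forall (s : sort) (F : set (set (el R s))),
    (forall F' : set (set (el R s)), F' `<=` F -> finite_set F' ->
       \bigcap_(A in F') A !=set0) ->
    \bigcap_(A in F) star_set M s A !=set0.

Record nonstandard_extension (R : realType) := NonstandardExtension {
  extension :> interp R;
  transfer : transfer_principle extension;
  enlargement : is_enlargement extension }.

Definition hyperreal (R : realType) (E : nonstandard_extension R) : Type :=
  E Reals.
Definition hypervec (R : realType) (E : nonstandard_extension R) (n : nat) :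
  Type := E (Vec n).

Definition star_real (R : realType) (E : nonstandard_extension R) (c : R) :
  hyperreal E := star_el E Reals c.

Definition starf (R : realType) (E : nonstandard_extension R) (n : nat)
  (f : 'rV[R]_n -> R) : hypervec E n -> hyperreal E :=
  star_fun E (Vec n) Reals f.

Section HyperrealField.
Context (R : realType) (E : nonstandard_extension R).
Local Notation hR := (hyperreal E).
Local Notation RR := (Prod Reals Reals).

Definition star1 (f : R -> R) : hR -> hR := star_fun E Reals Reals f.
Definition star2 (f : R -> R -> R) (x y : hR) : hR :=
  star_fun E RR Reals (fun p => f p.1 p.2) (star_pair E x y).
Definition star_rel (r : rel R) (x y : hR) : bool :=
  `[< star_set E RR [set p | r p.1 p.2] (star_pair E x y) >].

Let tr (p : formula R [::]) :
  @holds R (standard R) [::] p tt -> @holds R E [::] p tt :=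
  (transfer E p).1.

Local Notation ctx1 := [:: Reals].
Local Notation ctx2 := [:: Reals; Reals].
Local Notation ctx3 := [:: Reals; Reals; Reals].
Local Notation v0 := (Var R (V0 _ _)).
Local Notation v1 := (Var R (VS _ (V0 _ _))).
Local Notation v2 := (Var R (VS _ (VS _ (V0 _ _)))).
Local Notation T1 := (@App R _ Reals Reals).
Local Notation T2 f u v :=
  (@App R _ RR Reals (fun p : R * R => f p.1 p.2) (Pair u v)).
Local Notation RelF r u v :=
  (@In R _ RR [set p : R * R | r p.1 p.2] (Pair u v)).
Local Notation C c := (@Cst R _ Reals c).
Local Notation "'ALL1' p" := (@All R [::] Reals p) (at level 10).
Local Notation "'ALL2' p" := (ALL1 (@All R ctx1 Reals p)) (at level 10).
Local Notation "'ALL3' p" := (ALL2 (@All R ctx2 Reals p)) (at level 10).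

Let add := star2 +%R.
Let mul := star2 *%R.
Let zero := star_real E 0.
Let one := star_real E 1.

Fact hyper_addA : associative add.
Proof.
exact: (tr (p := ALL3 (Eq (T2 +%R v2 (T2 +%R v1 v0))
                          (T2 +%R (T2 +%R v2 v1) v0))) (@addrA R)).
Qed.
Fact hyper_addC : commutative add.
Proof.
exact: (tr (p := ALL2 (Eq (T2 +%R v1 v0) (T2 +%R v0 v1))) (@addrC R)).
Qed.
Fact hyper_add0 : left_id zero add.
Proof. exact: (tr (p := ALL1 (Eq (T2 +%R (C 0) v0) v0)) (@add0r R)). Qed.
Fact hyper_addN : left_inverse zero (star1 -%R) add.
Proof.
exact: (tr (p := ALL1 (Eq (T2 +%R (T1 -%R v0) v0) (C 0))) (@addNr R)).
Qed.
Fact hyper_mulA : associative mul.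
Proof.
exact: (tr (p := ALL3 (Eq (T2 *%R v2 (T2 *%R v1 v0))
                          (T2 *%R (T2 *%R v2 v1) v0))) (@mulrA R)).
Qed.
Fact hyper_mulC : commutative mul.
Proof.
exact: (tr (p := ALL2 (Eq (T2 *%R v1 v0) (T2 *%R v0 v1))) (@mulrC R)).
Qed.
Fact hyper_mul1 : left_id one mul.
Proof. exact: (tr (p := ALL1 (Eq (T2 *%R (C 1) v0) v0)) (@mul1r R)). Qed.
Fact hyper_mulDl : left_distributive mul add.
Proof.
exact: (tr (p := ALL3 (Eq (T2 *%R (T2 +%R v2 v1) v0)
             (T2 +%R (T2 *%R v2 v0) (T2 *%R v1 v0)))) (@mulrDl R)).
Qed.
Fact hyper_neq0 : one <> zero.
Proof.
exact: (tr (p := Not (@Eq R [::] Reals (C 1) (C 0))) (elimN eqP (oner_neq0 R))).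
Qed.
Fact hyper_mulV : forall x, x <> zero -> mul (star1 GRing.inv x) x = one.
Proof.
apply: (tr (p := ALL1 (Imp (Not (Eq v0 (C 0)))
                           (Eq (T2 *%R (T1 GRing.inv v0) v0) (C 1))))).
by move=> x /eqP x0; apply: mulVf.
Qed.
Fact hyper_inv0 : star1 GRing.inv zero = zero.
Proof.
exact: (tr (p := @Eq R [::] Reals (T1 GRing.inv (C 0)) (C 0)) (@invr0 R)).
Qed.

HB.instance Definition _ := gen_eqMixin hR.
HB.instance Definition _ := gen_choiceMixin hR.
HB.instance Definition _ :=
  GRing.isZmodule.Build hR hyper_addA hyper_addC hyper_add0 hyper_addN.

Fact hyper_neq0b : one != 0 :> hR. Proof. exact/eqP/hyper_neq0. Qed.

HB.instance Definition _ := GRing.Zmodule_isComNzRing.Build hR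
  hyper_mulA hyper_mulC hyper_mul1 hyper_mulDl hyper_neq0b.

Fact hyper_mulVb (x : hR) : x != 0 -> star1 GRing.inv x * x = 1.
Proof. by move=> /eqP; apply: hyper_mulV. Qed.

HB.instance Definition _ :=
  GRing.ComNzRing_isField.Build hR hyper_mulVb hyper_inv0.

Let le := star_rel <=%R.
Let lt := star_rel <%R.
Let norm := star1 Num.norm.

Fact hyper_le0D (x y : hR) : le 0 x -> le 0 y -> le 0 (x + y).
Proof.
rewrite !asboolE; move: x y.
exact: (tr (p := ALL2 (Imp (RelF <=%R (C 0) v1) (Imp (RelF <=%R (C 0) v0)
  (RelF <=%R (C 0) (T2 +%R v1 v0))))) (@addr_ge0 R)).
Qed.
Fact hyper_le0M (x y : hR) : le 0 x -> le 0 y -> le 0 (x * y).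
Proof.
rewrite !asboolE; move: x y.
exact: (tr (p := ALL2 (Imp (RelF <=%R (C 0) v1) (Imp (RelF <=%R (C 0) v0)
  (RelF <=%R (C 0) (T2 *%R v1 v0))))) (@mulr_ge0 R)).
Qed.
Fact hyper_le0_anti (x : hR) : le 0 x -> le x 0 -> x = 0.
Proof.
rewrite !asboolE; move: x.
apply: (tr (p := ALL1 (Imp (RelF <=%R (C 0) v0) (Imp (RelF <=%R v0 (C 0))
  (Eq v0 (C 0)))))).
by move=> x /= x0 x0'; apply/le_anti/andP.
Qed.
Fact hyper_sub_ge0 (x y : hR) : le 0 (y - x) = le x y.
Proof.
apply: asbool_equiv_eq; move: x y.
suff H : forall x y : hR,
    (star_set E RR [set p | p.1 <= p.2] (star_pair E zero (y - x)) ->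
     star_set E RR [set p | p.1 <= p.2] (star_pair E x y)) /\
    (star_set E RR [set p | p.1 <= p.2] (star_pair E x y) ->
     star_set E RR [set p | p.1 <= p.2] (star_pair E zero (y - x))) by [].
apply: (tr (p := ALL2 (And
  (Imp (RelF <=%R (C 0) (T2 +%R v0 (T1 -%R v1))) (RelF <=%R v1 v0))
  (Imp (RelF <=%R v1 v0) (RelF <=%R (C 0) (T2 +%R v0 (T1 -%R v1))))))).
by move=> x y /=; rewrite subr_ge0.
Qed.
Fact hyper_le0_total (x : hR) : le 0 x || le x 0.
Proof.
have H : forall x : hR,
    ~ star_set E RR [set p | p.1 <= p.2] (star_pair E zero x) ->
    star_set E RR [set p | p.1 <= p.2] (star_pair E x zero).
  apply: (tr (p := ALL1 (Imp (Not (RelF <=%R (C 0) v0))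
                             (RelF <=%R v0 (C 0))))).
  by move=> y /= /negP; rewrite -ltNge => /ltW.
by case: (boolP (le 0 x)) => //= /asboolPn h; apply/asboolP/H.
Qed.
Fact hyper_normN (x : hR) : norm (- x) = norm x.
Proof.
move: x; exact: (tr (p := ALL1 (Eq (T1 Num.norm (T1 -%R v0)) (T1 Num.norm v0)))
                    (@normrN R R)).
Qed.
Fact hyper_ge0_norm (x : hR) : le 0 x -> norm x = x.
Proof.
rewrite asboolE; move: x.
exact: (tr (p := ALL1 (Imp (RelF <=%R (C 0) v0) (Eq (T1 Num.norm v0) v0)))
           (@ger0_norm R)).
Qed.
Fact hyper_lt_def (x y : hR) : lt x y = (y != x) && le x y.
Proof.
have H : forall x y : hR,
    (star_set E RR [set p | p.1 < p.2] (star_pair E x y) -> y <> x /\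
      star_set E RR [set p | p.1 <= p.2] (star_pair E x y)) /\
    (y <> x /\ star_set E RR [set p | p.1 <= p.2] (star_pair E x y) ->
      star_set E RR [set p | p.1 < p.2] (star_pair E x y)).
  apply: (tr (p := ALL2 (And
    (Imp (RelF <%R v1 v0) (And (Not (Eq v0 v1)) (RelF <=%R v1 v0)))
    (Imp (And (Not (Eq v0 v1)) (RelF <=%R v1 v0)) (RelF <%R v1 v0))))).
  move=> a b /=; rewrite lt_def; split; first by move=> /andP[/eqP].
  by move=> [/eqP -> ->].
apply/idP/andP => [/asboolP /(H x y).1 [/eqP ? ?]|[/eqP ? /asboolP ?]].
  by split=> //; apply/asboolP.
by apply/asboolP/(H x y).2.
Qed.

HB.instance Definition _ := Num.IntegralDomain_isLeReal.Build hR
  hyper_le0D hyper_le0M hyper_le0_anti hyper_sub_ge0 hyper_le0_total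
  hyper_normN hyper_ge0_norm hyper_lt_def.

Fact star_realD (c d : R) : star_real E (c + d) = star_real E c + star_real E d.
Proof.
exact: (tr (p := @Eq R [::] Reals (C (c + d)) (T2 +%R (C c) (C d))) erefl).
Qed.
Fact star_realM (c d : R) : star_real E (c * d) = star_real E c * star_real E d.
Proof.
exact: (tr (p := @Eq R [::] Reals (C (c * d)) (T2 *%R (C c) (C d))) erefl).
Qed.

Definition hyper_scale (c : R) (x : hR) : hR := star_real E c * x.

Fact hyper_scaleA a b (x : hR) :
  hyper_scale a (hyper_scale b x) = hyper_scale (a * b) x.
Proof. by rewrite /hyper_scale star_realM mulrA. Qed.
Fact hyper_scale1 : left_id 1 hyper_scale.
Proof. exact: (@mul1r hR). Qed.
Fact hyper_scaleDr : right_distributive hyper_scale +%R.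
Proof. by move=> c x y; apply: mulrDr. Qed.
Fact hyper_scaleDl (x : hR) : {morph hyper_scale^~ x : a b / a + b}.
Proof. by move=> a b; rewrite /hyper_scale star_realD mulrDl. Qed.

HB.instance Definition _ := GRing.Zmodule_isLmodule.Build R hR
  hyper_scaleA hyper_scale1 hyper_scaleDr hyper_scaleDl.

Local Notation VecF n := (@App R _ (Vec n) Reals).

Fact starf0 n (x : hypervec E n) : starf (fun=> 0) x = 0.
Proof.
move: x; exact: (tr (p := @All R [::] (Vec n)
  (Eq (VecF n (fun=> 0) v0) (C 0))) (fun=> erefl)).
Qed.
Fact starfD n (f g : 'rV[R]_n -> R) (x : hypervec E n) :
  starf (f \+ g) x = starf f x + starf g x.
Proof.
move: x; exact: (tr (p := @All R [::] (Vec n)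
  (Eq (VecF n (f \+ g) v0) (T2 +%R (VecF n f v0) (VecF n g v0))))
  (fun=> erefl)).
Qed.
Fact starfM n (f g : 'rV[R]_n -> R) (x : hypervec E n) :
  starf (f \* g) x = starf f x * starf g x.
Proof.
move: x; exact: (tr (p := @All R [::] (Vec n)
  (Eq (VecF n (f \* g) v0) (T2 *%R (VecF n f v0) (VecF n g v0))))
  (fun=> erefl)).
Qed.
Fact starfZ n c (f : 'rV[R]_n -> R) (x : hypervec E n) :
  starf (fun y => c * f y) x = c *: starf f x.
Proof.
move: x; exact: (tr (p := @All R [::] (Vec n)
  (Eq (VecF n (fun y => c * f y) v0) (T2 *%R (C c) (VecF n f v0))))
  (fun=> erefl)).
Qed.

End HyperrealField.

Definition positive_infinitesimal (R : realType) (E : nonstandard_extension R)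
  (d : hyperreal E) : Prop :=
  0 < d /\ forall r : R, 0 < r -> d < star_real E r.

(* The library's norm on ['rV[R]_n] is the sup norm. *)
Definition enorm (R : realType) (n : nat) (x : 'rV[R]_n) : R :=
  Num.sqrt (\sum_(i < n) x 0 i ^+ 2).

Definition hyperball (R : realType) (E : nonstandard_extension R) (n : nat)
  (d : hyperreal E) : set (hypervec E n) :=
  [set xi | starf (@enorm R n) xi <= d].
Arguments hyperball {R E} n d.

HB.mixin Record Lmodule_isNonunitalComAlgebra (K : comNzRingType) A
    of GRing.Lmodule K A := {
  nmul : A -> A -> A;
  nmulA : associative nmul;
  nmulC : commutative nmul;
  nmulDl : left_distributive nmul +%R;
  nmulZl : forall (c : K) (a b : A), nmul (c *: a) b = c *: nmul a b }.

#[short(type="nonunitalComAlgType")]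
HB.structure Definition NonunitalComAlgebra (K : comNzRingType) :=
  {A of GRing.Lmodule K A & Lmodule_isNonunitalComAlgebra K A}.

Definition algebra_isomorphism (K : comNzRingType)
  (A B : nonunitalComAlgType K) (phi : A -> B) : Prop :=
  [/\ linear phi, {morph phi : a b / nmul a b} & bijective phi].

(* A function defined on the neighborhood [lf_dom] of 0 and vanishing at 0; as
   usual, the values of [lf_fun] outside [lf_dom] are irrelevant. *)
Record local_fun (R : realType) (n : nat) := LocalFun {
  lf_dom : set 'rV[R]_n;
  lf_fun :> 'rV[R]_n -> R;
  lf_nbhs : nbhs (0 : 'rV[R]_n) lf_dom;
  lf_at0 : lf_fun 0 = 0 }.

HB.instance Definition _ (R : realType) n := gen_eqMixin (local_fun R n).
HB.instance Definition _ (R : realType) n := gen_choiceMixin (local_fun R n).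

Definition germ_eq (R : realType) (n : nat) (f g : local_fun R n) : bool :=
  `[< exists V, [/\ nbhs (0 : 'rV[R]_n) V, V `<=` lf_dom f `&` lf_dom g &
                    forall x, V x -> f x = g x] >].

Section Germs.
Context (R : realType) (n : nat).
Local Notation lf := (local_fun R n).

Fact germ_eq_refl : reflexive (@germ_eq R n).
Proof.
by move=> f; apply/asboolP; exists (lf_dom f); split=> //; apply: lf_nbhs.
Qed.
Fact germ_eq_sym : symmetric (@germ_eq R n).
Proof.
move=> f g; apply/idP/idP => /asboolP[V [V0 VU fg]]; apply/asboolP;
  by exists V; split=> // x Vx; [rewrite setIC; apply: VU|rewrite fg].
Qed.
Fact germ_eq_trans : transitive (@germ_eq R n).
Proof.
move=> g f h /asboolP[V [V0 VU fg]] /asboolP[W [W0 WU gh]]; apply/asboolP.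
exists (V `&` W); split; first exact: filterI.
  by move=> x [/VU[? _] /WU[_ ?]].
by move=> x [Vx Wx]; rewrite fg // gh.
Qed.

Canonical germ_equiv :=
  EquivRel (@germ_eq R n) germ_eq_refl germ_eq_sym germ_eq_trans.

Definition germ := {eq_quot germ_equiv}.
HB.instance Definition _ : EqQuotient lf germ_equiv germ := EqQuotient.on germ.
HB.instance Definition _ := Choice.on germ.

Definition germ_of (f : lf) : germ := \pi_germ f.

Lemma germ_ofP f g : germ_of f = germ_of g <-> germ_eq f g.
Proof. by split=> [/eqmodP|?]; [|apply/eqmodP]. Qed.

Lemma germ_ofK (a : germ) : germ_of (repr a) = a.
Proof. exact: reprK. Qed.

Definition lf_zero : lf := @LocalFun R n setT (fun=> 0) filterT erefl.
Definition lf_opp (f : lf) : lf := @LocalFun R n (lf_dom f) (\- f) (lf_nbhs f)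
  (etrans (congr1 -%R (lf_at0 f)) (oppr0 R)).
Definition lf_add (f g : lf) : lf := @LocalFun R n (lf_dom f `&` lf_dom g)
  (f \+ g) (filterI (lf_nbhs f) (lf_nbhs g))
  (etrans (congr2 +%R (lf_at0 f) (lf_at0 g)) (addr0 0)).
Definition lf_mul (f g : lf) : lf := @LocalFun R n (lf_dom f `&` lf_dom g)
  (f \* g) (filterI (lf_nbhs f) (lf_nbhs g))
  (etrans (congr2 *%R (lf_at0 f) (lf_at0 g)) (mulr0 0)).
Definition lf_scale (c : R) (f : lf) : lf := @LocalFun R n (lf_dom f)
  (fun x => c * f x) (lf_nbhs f)
  (etrans (congr1 ( *%R c) (lf_at0 f)) (mulr0 c)).

Definition germ_zero : germ := germ_of lf_zero.
Definition germ_opp (a : germ) : germ := germ_of (lf_opp (repr a)).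
Definition germ_add (a b : germ) : germ := germ_of (lf_add (repr a) (repr b)).
Definition germ_mul (a b : germ) : germ := germ_of (lf_mul (repr a) (repr b)).
Definition germ_scale c (a : germ) : germ := germ_of (lf_scale c (repr a)).

Let repr_germ f : exists V, [/\ nbhs (0 : 'rV[R]_n) V,
  V `<=` lf_dom (repr (germ_of f)) `&` lf_dom f &
  forall x, V x -> repr (germ_of f) x = f x].
Proof. by apply/asboolP; apply/germ_ofP; rewrite germ_ofK. Qed.

Lemma germ_oppE f : germ_opp (germ_of f) = germ_of (lf_opp f).
Proof.
have [V [V0 VU h]] := repr_germ f; apply/germ_ofP/asboolP; exists V.
by split=> // x Vx /=; rewrite h.
Qed.
Lemma germ_scaleE c f : germ_scale c (germ_of f) = germ_of (lf_scale c f).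
Proof.
have [V [V0 VU h]] := repr_germ f; apply/germ_ofP/asboolP; exists V.
by split=> // x Vx /=; rewrite h.
Qed.
Lemma germ_addE f g :
  germ_add (germ_of f) (germ_of g) = germ_of (lf_add f g).
Proof.
have [V [V0 VU h]] := repr_germ f; have [W [W0 WU k]] := repr_germ g.
apply/germ_ofP/asboolP; exists (V `&` W); split; first exact: filterI.
  by move=> x [/VU[? ?] /WU[? ?]].
by move=> x [Vx Wx] /=; rewrite h // k.
Qed.
Lemma germ_mulE f g :
  germ_mul (germ_of f) (germ_of g) = germ_of (lf_mul f g).
Proof.
have [V [V0 VU h]] := repr_germ f; have [W [W0 WU k]] := repr_germ g.
apply/germ_ofP/asboolP; exists (V `&` W); split; first exact: filterI.
  by move=> x [/VU[? ?] /WU[? ?]].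
by move=> x [Vx Wx] /=; rewrite h // k.
Qed.
Definition germE := (germ_oppE, germ_scaleE, germ_addE, germ_mulE).

Let germ_ext (f g : lf) : f =1 g -> germ_of f = germ_of g.
Proof.
move=> fg; apply/germ_ofP/asboolP; exists (lf_dom f `&` lf_dom g).
by split=> [|//|x _]; [apply: filterI; apply: lf_nbhs|apply: fg].
Qed.

Fact germ_addA : associative germ_add.
Proof.
move=> a b c; rewrite -(germ_ofK a) -(germ_ofK b) -(germ_ofK c) !germE.
by apply: germ_ext => x /=; rewrite addrA.
Qed.
Fact germ_addC : commutative germ_add.
Proof.
move=> a b; rewrite -(germ_ofK a) -(germ_ofK b) !germE.
by apply: germ_ext => x /=; rewrite addrC.
Qed.
Fact germ_add0 : left_id germ_zero germ_add.
Proof.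
move=> a; rewrite -(germ_ofK a) !germE.
by apply: germ_ext => x /=; rewrite add0r.
Qed.
Fact germ_addN : left_inverse germ_zero germ_opp germ_add.
Proof.
move=> a; rewrite -(germ_ofK a) !germE.
by apply: germ_ext => x /=; rewrite addNr.
Qed.

HB.instance Definition _ :=
  GRing.isZmodule.Build germ germ_addA germ_addC germ_add0 germ_addN.

Fact germ_scaleA c d (a : germ) :
  germ_scale c (germ_scale d a) = germ_scale (c * d) a.
Proof.
rewrite -(germ_ofK a) !germE.
by apply: germ_ext => x /=; rewrite mulrA.
Qed.
Fact germ_scale1 : left_id 1 germ_scale.
Proof.
move=> a; rewrite -(germ_ofK a) !germE.
by apply: germ_ext => x /=; rewrite mul1r.
Qed.
Fact germ_scaleDr : right_distributive germ_scale +%R.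
Proof.
move=> c a b; rewrite -(germ_ofK a) -(germ_ofK b) /+%R /= !germE.
by apply: germ_ext => x /=; rewrite mulrDr.
Qed.
Fact germ_scaleDl (a : germ) : {morph germ_scale^~ a : c d / c + d}.
Proof.
move=> c d; rewrite -(germ_ofK a) [RHS]/+%R /= !germE.
by apply: germ_ext => x /=; rewrite mulrDl.
Qed.

HB.instance Definition _ := GRing.Zmodule_isLmodule.Build R germ
  germ_scaleA germ_scale1 germ_scaleDr germ_scaleDl.

Fact germ_mulA : associative germ_mul.
Proof.
move=> a b c; rewrite -(germ_ofK a) -(germ_ofK b) -(germ_ofK c) !germE.
by apply: germ_ext => x /=; rewrite mulrA.
Qed.
Fact germ_mulC : commutative germ_mul.
Proof.
move=> a b; rewrite -(germ_ofK a) -(germ_ofK b) !germE.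
by apply: germ_ext => x /=; rewrite mulrC.
Qed.
Fact germ_mulDl : left_distributive germ_mul +%R.
Proof.
move=> a b c; rewrite -(germ_ofK a) -(germ_ofK b) -(germ_ofK c) /+%R /= !germE.
by apply: germ_ext => x /=; rewrite mulrDl.
Qed.
Fact germ_mulZl c (a b : germ) : germ_mul (c *: a) b = c *: germ_mul a b.
Proof.
rewrite -[LHS]/(germ_mul (germ_scale c a) b).
rewrite -[RHS]/(germ_scale c (germ_mul a b)).
rewrite -(germ_ofK a) -(germ_ofK b) !germE.
by apply: germ_ext => x /=; rewrite mulrA.
Qed.

HB.instance Definition _ := Lmodule_isNonunitalComAlgebra.Build R germ
  germ_mulA germ_mulC germ_mulDl germ_mulZl.

Definition germ_rel (r : rel R) (a b : germ) : Prop :=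
  exists U (f g : lf),
    [/\ nbhs (0 : 'rV[R]_n) U, germ_of f = a /\ germ_of g = b,
        U `<=` lf_dom f `&` lf_dom g &
        forall x, U x -> r (f x) (g x)].

End Germs.

Definition germ_lt (R : realType) n : germ R n -> germ R n -> Prop :=
  germ_rel (fun x y => x < y).
Definition germ_le (R : realType) n : germ R n -> germ R n -> Prop :=
  germ_rel (fun x y => x <= y).
Definition germ_gt (R : realType) n : germ R n -> germ R n -> Prop :=
  germ_rel (fun x y => x > y).
Definition germ_ge (R : realType) n : germ R n -> germ R n -> Prop :=
  germ_rel (fun x y => x >= y).

Section StandardFunctions.
Context (R : realType) (E : nonstandard_extension R) (n : nat).
Context (d : hyperreal E).

(* For infinitesimal [d] the ball lies in the extension of every standard
   neighborhood of 0, so only the values of [f] on its domain matter here. *)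
Definition ball_restr (f : 'rV[R]_n -> R) :
    hyperball n d -> hyperreal E := fun xi => starf f (\val xi).

Definition is_std_fun : {pred (hyperball n d -> hyperreal E)} :=
  fun phi => `[< exists f : local_fun R n, phi = ball_restr f >].

Fact is_std_fun_submod : GRing.submod_closed is_std_fun.
Proof.
split; first by apply/asboolP; exists (lf_zero R n); apply/funext => xi;
  rewrite /ball_restr starf0.
move=> c _ _ /asboolP[f ->] /asboolP[g ->]; apply/asboolP.
exists (lf_add (lf_scale c f) g); apply/funext => xi.
by rewrite /ball_restr starfD starfZ.
Qed.
HB.instance Definition _ :=
  GRing.isSubmodClosed.Build R _ is_std_fun is_std_fun_submod.

Fact is_std_funM :
  {in is_std_fun &, forall phi psi, phi * psi \in is_std_fun}.
Proof.
move=> _ _ /asboolP[f ->] /asboolP[g ->]; apply/asboolP.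
by exists (lf_mul f g); apply/funext => xi; rewrite /ball_restr starfM.
Qed.

Record std_fun := StdFun {
  std_val :> hyperball n d -> hyperreal E;
  std_valP : std_val \in is_std_fun }.

HB.instance Definition _ := [isSub for std_val].
HB.instance Definition _ := [Choice of std_fun by <:].
HB.instance Definition _ := [SubChoice_isSubLmodule of std_fun by <:].

Definition std_mul (a b : std_fun) : std_fun :=
  StdFun (is_std_funM (std_valP a) (std_valP b)).

Fact std_mulA : associative std_mul.
Proof. by move=> a b c; apply/val_inj/mulrA. Qed.
Fact std_mulC : commutative std_mul.
Proof. by move=> a b; apply/val_inj/mulrC. Qed.
Fact std_mulDl : left_distributive std_mul +%R.
Proof. by move=> a b c; apply/val_inj/mulrDl. Qed.
Fact std_mulZl c (a b : std_fun) : std_mul (c *: a) b = c *: std_mul a b.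
Proof. by apply/val_inj/funext => xi; rewrite /= /GRing.scale /= -mulrA. Qed.

HB.instance Definition _ := Lmodule_isNonunitalComAlgebra.Build R std_fun
  std_mulA std_mulC std_mulDl std_mulZl.

Fact ball_restr_std (f : local_fun R n) : ball_restr f \in is_std_fun.
Proof. by apply/asboolP; exists f. Qed.

Definition std_of (f : local_fun R n) : std_fun := StdFun (ball_restr_std f).

(* Defined on the canonical representative of the germ: that the value is the
   same for all representatives has to be proved, and uses that [d] is
   infinitesimal. *)
Definition Rdelta (a : germ R n) : std_fun := std_of (repr a).

End StandardFunctions.

Arguments Rdelta {R E} n d a.

(* Main.v *)
Require Import Defs.
From mathcomp Require Import all_boot all_order all_algebra.
From mathcomp Require Import all_classical all_reals all_analysis.
Import Order.TTheory GRing.Theory Num.Theory numFieldNormedType.Exports.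
Local Open Scope classical_set_scope.
Local Open Scope ring_scope.

(** A property of points of R^n holds near 0 exactly when its extension holds
    on the single infinitesimal ball of radius [d] ([nbhs0_hyperball]), and the
    whole theorem is a reading of this equivalence.  If [A] is a neighborhood
    of 0, it contains a standard Euclidean ball of some radius [r > 0]; by
    transfer the extension of [A] contains the ball of radius [*r], which
    exceeds [d].  Conversely, if the extension of [A] contains the ball of
    radius [d], then [d] is a witness in the extension of the sentence saying
    that some ball of positive radius is included in [A]; this sentence
    mentions [A] but not [d], so by transfer a standard radius exists.

    Let now [A] be the set of points where two functions agree, or where their
    values are in a given relation.  By transfer, a point lies in the extension
    of [A] exactly when the values of the extended functions agree there, or
    are in the extended relation ([star_set_eqP], [star_set_relP]).  Hence two
    local functions have the same germ if and only if their extensions agree on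
    the ball ([germ_of_eqP]): one direction makes the restriction map
    independent of the representative, the other makes it injective, and
    surjectivity holds by definition of the standard functions on the ball.
    The order isomorphism follows in the same way from [germ_rel_hyperball]. *)

Arguments star_set {R} i s.
Arguments star_pair {R} i {s t}.

(** * Euclidean balls as a base of neighborhoods of 0 *)

Section EuclideanNorm.
Context {R : realType} {n : nat}.
Implicit Type x : 'rV[R]_n.

Lemma norm_entry_le_enorm x i : `|x 0 i| <= enorm x.
Proof.
rewrite /enorm -sqrtr_sqr ler_wsqrtr // (bigD1 i) //= lerDl.
by apply: sumr_ge0 => j _; apply: sqr_ge0.
Qed.

(** The optimal factor is the square root of [n]; [n.+1] avoids the root and
    stays invertible for [n = 0]. *)
Lemma enorm_le_sup_bound (b : R) x :
  0 <= b -> (forall i, `|x 0 i| <= b) -> enorm x <= n.+1%:R * b.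
Proof.
move=> b0 xb; have h0 : 0 <= n.+1%:R * b by rewrite mulr_ge0.
rewrite /enorm -[leRHS](ger0_norm h0) -[leRHS]sqrtr_sqr; apply: ler_wsqrtr.
apply: (@le_trans _ _ (\sum_(i < n) b ^+ 2)).
  by apply: ler_sum => i _; rewrite -real_normK ?num_real // lerXn2r ?nnegrE.
rewrite sumr_const card_ord -[leLHS]mulr_natl exprMn.
apply: ler_wpM2r; first exact: sqr_ge0.
by rewrite -natrX ler_nat (leq_trans (leqnSn n)) // leq_pmulr.
Qed.

Lemma nbhs0_enormP (A : set 'rV[R]_n) : nbhs (0 : 'rV[R]_n) A <->
  exists2 r : R, 0 < r & forall x, enorm x <= r -> A x.
Proof.
split=> [/nbhs_ballP[e /= e0 eA]|[r r0 rA]].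
  (* Balls for the sup norm are open: halving the radius makes room for the
     closed Euclidean ball. *)
  exists (e / 2); first by rewrite divr_gt0.
  move=> x xe; apply: eA; split=> // i j.
  rewrite /ball /= mxE sub0r normrN ord1.
  rewrite (le_lt_trans (norm_entry_le_enorm x j)) // (le_lt_trans xe) //.
  by rewrite ltr_pdivrMr // ltr_pMr // ltr1n.
apply/nbhs_ballP; exists (r / n.+1%:R) => /=; first by rewrite divr_gt0.
move=> x [_ xb]; apply: rA.
have b0 : 0 <= r / n.+1%:R by rewrite divr_ge0 // ltW.
rewrite -[leRHS](divfK (_ : n.+1%:R != 0)) ?pnatr_eq0 // mulrC.
apply: enorm_le_sup_bound => // i.
by have := xb 0 i; rewrite /ball /= mxE sub0r normrN => /ltW.
Qed.

End EuclideanNorm.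

(** * Consequences of transfer *)

Section Transfer.
Context {R : realType} {E : nonstandard_extension R} {n : nat}.
Implicit Types (A : set 'rV[R]_n) (f g : 'rV[R]_n -> R) (r : rel R).

Local Notation v0 := (Var R (V0 _ _)).
Local Notation v1 := (Var R (VS _ (V0 _ _))).
Local Notation relF r u v :=
  (@In R _ (Prod Reals Reals) [set p : R * R | r p.1 p.2] (Pair u v)).
Local Notation appF f := (@App R _ (Vec n) Reals f).
Local Notation starS A := (star_set E (Vec n) A).

(** The extension of a definable set is defined by the same formula: this is
    transfer of the universal sentence that names the set and asserts the
    equivalence. *)
Lemma star_set_definable {s} (p : formula R [:: s]) (a : E s) :
  star_set E s [set x | @holds R (standard R) [:: s] p (x, tt)] a <->
  @holds R E [:: s] p (a, tt).
Proof.
pose S : set (el R s) := [set x | @holds R (standard R) [:: s] p (x, tt)].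
have [+ _] := transfer E
  (@All R [::] s (And (Imp (In S v0) p) (Imp p (In S v0)))).
by move=> /(_ (fun _ => conj id id) a) [? ?]; split.
Qed.

Lemma star_set_relP r f g (xi : hypervec E n) :
  starS [set x | r (f x) (g x)] xi <-> star_rel r (starf f xi) (starf g xi).
Proof.
have fg := star_set_definable (relF r (appF f v0) (appF g v0)) xi.
by split=> [/fg ?|/asboolP /fg //]; apply/asboolP.
Qed.

Lemma star_set_eqP f g (xi : hypervec E n) :
  starS [set x | f x = g x] xi <-> starf f xi = starf g xi.
Proof. exact: (star_set_definable (Eq (appF f v0) (appF g v0)) xi). Qed.

Local Notation ball_subF A rad := (@All R _ (Vec n)
  (Imp (relF <=%R (appF (@enorm R n) v0) rad) (@In R _ (Vec n) A v0))).

(** One ball of infinitesimal radius decides what a neighborhood of 0 is: that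
    [d] lies below every standard positive radius gives the direct implication,
    and positivity of [d] gives the converse. *)
Lemma nbhs0_hyperball {d : hyperreal E} (d_inf : positive_infinitesimal d) A :
  nbhs (0 : 'rV[R]_n) A <-> hyperball n d `<=` starS A.
Proof.
case: d_inf => d0 d_small; split=> [/nbhs0_enormP[r r0 rA] xi xid|dA].
  have [+ _] := transfer E (ball_subF A (@Cst R _ Reals r)).
  move=> /(_ rA xi); apply; apply/asboolP.
  exact: le_trans xid (ltW (d_small r r0)).
(* The radius is quantified, so that the sentence is standard although [d] is
   not; only its truth, not the value of the witness, comes back. *)
have [_] := transfer E (@Ex R [::] Reals
  (And (relF <%R (@Cst R _ Reals 0) v0) (ball_subF A v1))).
case=> [|r [r0 rA]]; last by apply/nbhs0_enormP; exists r.
by exists d; split=> [|xi xid]; [apply/asboolP/d0|apply/dA/asboolP/xid].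
Qed.

End Transfer.

(** * Germs *)

Section GermsNearZero.
Context {R : realType} {n : nat}.
Implicit Types f g : local_fun R n.

(** The domains of [f] and [g] are neighborhoods of 0, so intersecting with them
    removes them from the description of germs; the same holds for
    [germ_rel_nbhs]. *)
Lemma germ_of_eq_nbhs f g :
  germ_of f = germ_of g <-> nbhs (0 : 'rV[R]_n) [set x | f x = g x].
Proof.
split=> [/germ_ofP/asboolP[V [V0 _ fg]]|fg]; first exact: filterS V0.
apply/germ_ofP/asboolP.
exists ([set x | f x = g x] `&` (lf_dom f `&` lf_dom g)).
split=> [|x []//|x []//].
by apply: filterI => //; apply: filterI; apply: lf_nbhs.
Qed.

Lemma germ_rel_nbhs (r : rel R) f g : germ_rel r (germ_of f) (germ_of g) <->
  nbhs (0 : 'rV[R]_n) [set x | r (f x) (g x)].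
Proof.
split=> [[U [f' [g' [U0 [/germ_of_eq_nbhs ff' /germ_of_eq_nbhs gg'] _ r']]]]|fg].
  apply: filterS3 U0 ff' gg' => x Ux /= <- <-; exact: r'.
exists ([set x | r (f x) (g x)] `&` (lf_dom f `&` lf_dom g)), f, g.
split=> [||x []//|x []//]; last by [].
by apply: filterI => //; apply: filterI; apply: lf_nbhs.
Qed.

(** Reversing the relation on the standard side reduces [>] and [>=] to [<] and
    [<=], whose extensions are by construction the order of the hyperreals. *)
Lemma germ_rel_flip (r : rel R) (a b : germ R n) :
  germ_rel (fun x y => r y x) a b <-> germ_rel r b a.
Proof.
by rewrite -(germ_ofK a) -(germ_ofK b); split=> /germ_rel_nbhs H;
  apply/germ_rel_nbhs.
Qed.

End GermsNearZero.

Section Restriction.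
Context {R : realType} {E : nonstandard_extension R} {n : nat}.
Context {d : hyperreal E} (d_inf : positive_infinitesimal d).
Implicit Types f g : local_fun R n.

Lemma germ_of_eqP f g : germ_of f = germ_of g <->
  forall xi, hyperball n d xi -> starf f xi = starf g xi.
Proof.
rewrite germ_of_eq_nbhs (nbhs0_hyperball d_inf).
by split=> fg xi /fg /star_set_eqP.
Qed.

Lemma germ_rel_hyperball (r : rel R) f g :
  germ_rel r (germ_of f) (germ_of g) <->
  forall xi, hyperball n d xi -> star_rel r (starf f xi) (starf g xi).
Proof.
rewrite germ_rel_nbhs (nbhs0_hyperball d_inf).
by split=> fg xi /fg /star_set_relP.
Qed.

Lemma std_of_eqP f g : std_of d f = std_of d g <-> germ_of f = germ_of g.
Proof.
rewrite germ_of_eqP; split=> [fg xi xid|fg].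
  have xiB : xi \in hyperball n d by rewrite inE.
  exact: (congr1 (fun phi : std_fun n d => phi (SigSub xiB)) fg).
apply/val_inj/funext => xi; apply: fg; have := valP xi.
by rewrite inE.
Qed.

(** The restriction map is well defined: the chosen representative of the germ
    of [f] has the same extension as [f] on the ball. *)
Lemma Rdelta_germ_of f : Rdelta n d (germ_of f) = std_of d f.
Proof. by apply/std_of_eqP; rewrite germ_ofK. Qed.

Lemma Rdelta_bij : bijective (Rdelta n d).
Proof.
have std_fun_ex (phi : std_fun n d) : exists f, phi = std_of d f.
  by have /asboolP[f phif] := std_valP phi; exists f; apply/val_inj.
pose lift phi := sval (cid (std_fun_ex phi)).
have liftK phi : std_of d (lift phi) = phi.
  by rewrite /lift; case: cid.
exists (fun phi => germ_of (lift phi)) => [a|phi].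
  by rewrite -[RHS]germ_ofK; apply/std_of_eqP; rewrite liftK.
by rewrite Rdelta_germ_of liftK.
Qed.

Lemma Rdelta_isomorphism : algebra_isomorphism (Rdelta n d).
Proof.
split; last exact: Rdelta_bij.
  move=> c a b; rewrite -(germ_ofK a) -(germ_ofK b).
  (* [germE] speaks of the concrete operations on germs. *)
  rewrite -[c *: _ + _]/(germ_add (germ_scale c _) _) !germE !Rdelta_germ_of.
  by apply/val_inj/funext => xi; rewrite /= /ball_restr starfD starfZ.
move=> a b; rewrite -(germ_ofK a) -(germ_ofK b).
rewrite -[nmul (germ_of _) _]/(germ_mul _ _) !germE !Rdelta_germ_of.
by apply/val_inj/funext => xi; rewrite /= /ball_restr starfM.
Qed.

End Restriction.

(** * The isomorphism theorem *)

Theorem corollary2p1 (R : realType) (E : nonstandard_extension R) (n : nat)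
    (d : hyperreal E) (d_inf : positive_infinitesimal d) :
  (forall (U : set 'rV[R]_n) (f : 'rV[R]_n -> R) (U0 : nbhs (0 : 'rV[R]_n) U),
     (forall xi, hyperball n d xi -> starf f xi = 0) ->
     (exists V : set 'rV[R]_n,
        [/\ nbhs (0 : 'rV[R]_n) V, V `<=` U & forall x, V x -> f x = 0]) /\
     (exists f0 : f 0 = 0, germ_of (LocalFun U0 f0) = 0)) /\
  ((forall (f : local_fun R n) (xi : hypervec E n) (xiB : xi \in hyperball n d),
      Rdelta n d (germ_of f) (SigSub xiB) = starf f xi) /\
   algebra_isomorphism (Rdelta n d)) /\
  (forall f g : local_fun R n,
     [/\ germ_lt (germ_of f) (germ_of g) <->
           (forall xi, hyperball n d xi -> starf f xi < starf g xi),
         germ_le (germ_of f) (germ_of g) <->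
           (forall xi, hyperball n d xi -> starf f xi <= starf g xi),
         germ_gt (germ_of f) (germ_of g) <->
           (forall xi, hyperball n d xi -> starf f xi > starf g xi) &
         germ_ge (germ_of f) (germ_of g) <->
           (forall xi, hyperball n d xi -> starf f xi >= starf g xi)]).
Proof.
split; [|split; [split|]].
- move=> U f U0 f_eq0.
  have f_near0 : nbhs (0 : 'rV[R]_n) [set x | f x = 0].
    apply/(nbhs0_hyperball d_inf) => xi xid.
    by apply/star_set_eqP; rewrite f_eq0 // starf0.
  split.
    by exists ([set x | f x = 0] `&` U); split=> [|x []//|x []//]; exact: filterI.
  by exists (nbhs_singleton f_near0); apply/germ_of_eq_nbhs.
- by move=> f xi xiB; rewrite (Rdelta_germ_of d_inf).
- exact: Rdelta_isomorphism.
move=> f g; split.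
- exact: germ_rel_hyperball.
- exact: germ_rel_hyperball.
- rewrite /germ_gt (germ_rel_flip <%R); exact: germ_rel_hyperball.
- rewrite /germ_ge (germ_rel_flip <=%R); exact: germ_rel_hyperball.
Qed.
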